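(* Let $M$ be a left $R$-module which is a self-progenerator in $\sigma[M]$. Assume that $M$ is strongly harmonic and that $\Lambda^{fi}(M)$ is compact. Then $\mathrm{pt}(\Psi(M))$ is homeomorphic to $Max^{fi}(M)$.
   Context: $R$ is an associative ring with identity; modules are unital left $R$-modules. A submodule $N\leq M$ is fully invariant if $f(N)\subseteq N$ for all $f\in\mathrm{End}_R(M)$; $\Lambda^{fi}(M)$ is the complete lattice of fully invariant submodules of $M$ ordered by inclusion, and $Max^{fi}(M)$ is the set of its coatoms (maximal proper elements), with the topology whose open sets are $\{\mathcal{M}\in Max^{fi}(M)\mid K\nleq\mathcal{M}\}$, $K\in\Lambda^{fi}(M)$. $\sigma[M]$ is the full subcategory of $R$-Mod of all modules that embed in a quotient of some direct sum $M^{(X)}$. $M$ is $N$-projective if for every epimorphism $\rho\colon N\to X$ and every homomorphism $\alpha\colon M\to X$ there is $\beta\colon M\to N$ with $\rho\beta=\alpha$; $M$ is projective in $\sigma[M]$ if it is $N$-projective for every $N\in\sigma[M]$. $M$ is a self-progenerator in $\sigma[M]$ if it is projective in $\sigma[M]$ and every submodule of $M$ is $M$-generated (a quotient of some $M^{(X)}$). For $N,L\leq M$ put $N_ML=\sum\{f(N)\mid f\in\mathrm{Hom}_R(M,L)\}$. For $K\leq M$ put $\mathrm{Ann}_M(K)=\bigcap\{\ker f\mid f\in\mathrm{Hom}_R(M,K)\}$. $M$ is strongly harmonic if for every two distinct $N,L\in Max^{fi}(M)$ there exist $N',L'\in\Lambda^{fi}(M)$ with $L'\nleq L$, $N'\nleq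 N$ and $L'_MN'=0$. $\Lambda^{fi}(M)$ is compact if whenever $M=\sum_{i\in I}N_i$ with all $N_i\in\Lambda^{fi}(M)$, there is a finite $F\subseteq I$ with $M=\sum_{i\in F}N_i$. $\Psi(M)=\{N\in\Lambda^{fi}(M)\mid N+\mathrm{Ann}_M(Rn)=M\text{ for all }n\in N\}$, ordered by inclusion; it is a frame with joins given by sums and finite meets by intersections. For a frame $A$, $\mathrm{pt}(A)$ is the set of points of $A$ (elements $p\neq1$ such that $a\wedge b\leq p$ implies $a\leq p$ or $b\leq p$), with open sets $\{p\in\mathrm{pt}(A)\mid a\nleq p\}$, $a\in A$. *)

(* Defs.v *)
From HB Require Import structures.
From mathcomp Require Import all_boot all_order all_algebra.
From mathcomp Require Import all_classical topology.

Set Implicit Arguments.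
Unset Strict Implicit.
Unset Printing Implicit Defensive.

Import Order.TTheory GRing.Theory.

Local Open Scope ring_scope.
Local Open Scope classical_set_scope.

HB.mixin Record TBLattice_isFrame (d : Order.disp_t) T
    of Order.TBLattice d T := {
  bigjoin : set T -> T;
  bigjoin_ub : forall (A : set T) (x : T), A x -> (x <= bigjoin A)%O;
  bigjoin_le : forall (A : set T) (y : T),
    (forall x, A x -> (x <= y)%O) -> (bigjoin A <= y)%O;
  meet_bigjoin : forall (x : T) (A : set T),
    Order.meet x (bigjoin A) = bigjoin [set Order.meet x y | y in A]
}.

#[short(type="frameType")]
HB.structure Definition Frame (d : Order.disp_t) :=
  {T of TBLattice_isFrame d T & Order.TBLattice d T}.

Section Points.
Context {d : Order.disp_t} (A : frameType d).

Record pt := Pt {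
  pt_val : A;
  pt_neq1 : pt_val <> \top%O;
  pt_prime : forall a b : A, (Order.meet a b <= pt_val)%O ->
    (a <= pt_val)%O \/ (b <= pt_val)%O
}.

HB.instance Definition _ := gen_eqMixin pt.
HB.instance Definition _ := gen_choiceMixin pt.

Definition pt_open : set_system pt :=
  [set U | exists a : A, U = [set p : pt | ~ (a <= pt_val p)%O]].

Lemma pt_openT : pt_open setT.
Proof.
exists \top%O; apply/seteqP; split=> // p _ /=; rewrite le1x => /eqP.
exact: pt_neq1.
Qed.

Lemma pt_openI : setI_closed pt_open.
Proof.
move=> _ _ [a ->] [b ->]; exists (Order.meet a b).
apply/seteqP; split=> p /=.
- by move=> [na nb] /pt_prime[].
- by move=> nab; split=> le_p; apply: nab; rewrite (le_trans _ le_p) ?leIl ?leIr.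
Qed.

Lemma pt_open_bigU (I : Type) (f : I -> set pt) :
  (forall i, pt_open (f i)) -> pt_open (\bigcup_i f i).
Proof.
move=> fop; exists (bigjoin [set a | exists i, f i = [set p : pt | ~ (a <= pt_val p)%O]]).
apply/seteqP; split=> p /=.
- move=> [i _ fip] le_p; have [a fi] := fop i.
  move: fip; rewrite fi /=; apply; apply: le_trans le_p.
  by apply: bigjoin_ub; exists i.
- move=> nle; apply: contrapT => np; apply: nle; apply: bigjoin_le.
  move=> a [i fi]; apply: contrapT => na; apply: np; exists i => //.
  by rewrite fi.
Qed.

HB.instance Definition _ :=
  isOpenTopological.Build pt pt_openT pt_openI pt_open_bigU.

End Points.

Definition homeomorphism (X Y : topologicalType) (f : X -> Y) : Prop :=
  [/\ bijective f, continuous f & forall U : set X, open U -> open (f @` U)].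

Definition homeomorphic (X Y : topologicalType) : Prop :=
  exists f : X -> Y, homeomorphism f.

Section DirectSum.
Variables (R : pzRingType) (X : Type) (M : lmodType R).

Definition fin_supp : {pred X -> M} :=
  fun f => `[< finite_set [set x | f x <> 0] >].

Lemma fin_supp_closed : subsemimod_closed fin_supp.
Proof.
split; first split.
- apply/asboolP; rewrite [X in finite_set X](_ : _ = set0) //.
  by apply/seteqP; split=> x.
- move=> f g /asboolP ff /asboolP fg; apply/asboolP.
  apply: (@sub_finite_set _ _ ([set x | f x <> 0] `|` [set x | g x <> 0])).
    move=> x /= fgx; apply: contrapT => /not_orP[/contrapT fx /contrapT gx].
    by apply: fgx; have -> : (f + g) x = f x + g x by []; rewrite fx gx addr0.
  by rewrite finite_setU.
- move=> a f /asboolP ff; apply/asboolP; apply: sub_finite_set ff => x /= afx fx.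
  by apply: afx; have -> : (a *: f) x = a *: f x by []; rewrite fx scaler0.
Qed.

HB.instance Definition _ :=
  GRing.isSubmodClosed.Build R (X -> M) fin_supp fin_supp_closed.

(* $M^{(X)}$ as the module of finitely supported functions from X to M *)
Record dsum := DSum { dsum_val :> X -> M; _ : dsum_val \in fin_supp }.

HB.instance Definition _ := [isSub for dsum_val].
HB.instance Definition _ := [Choice of dsum by <:].
HB.instance Definition _ := [SubChoice_isSubLmodule of dsum by <:].

End DirectSum.

Section Submodules.
Variables (R : pzRingType) (M : lmodType R).

Definition submodule (N : set M) : Prop := submod_closed [in N].

Lemma submoduleP (N : set M) : submodule N <->
  N 0 /\ forall a u v, N u -> N v -> N (a *: u + v).
Proof.
split=> [[N0 Nl]|[N0 Nl]]; split.
- by rewrite inE in N0.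
- by move=> a u v Nu Nv; move: (Nl a u v); rewrite !inE; apply.
- by rewrite inE.
- by move=> a u v; rewrite !inE; apply: Nl.
Qed.

Definition smpred (N : set M) (hN : submodule N) : {pred M} := [in N].

HB.instance Definition _ N (hN : submodule N) :=
  GRing.isSubmodClosed.Build R M (smpred hN) (GRing.submod_closed_semi hN).

Record submod (N : set M) (hN : submodule N) :=
  Submod { submod_val :> M; _ : submod_val \in smpred hN }.

HB.instance Definition _ N (hN : submodule N) := [isSub for @submod_val N hN].
HB.instance Definition _ N (hN : submodule N) :=
  [Choice of submod hN by <:].
HB.instance Definition _ N (hN : submodule N) :=
  [SubChoice_isSubLmodule of submod hN by <:].
End Submodules.

Section ModuleNotions.
Variable R : pzRingType.
Implicit Types M N : lmodType R.

Definition generated M N : Prop :=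
  exists (X : Type) (p : {linear dsum X M -> N}), range p = setT.

Definition in_sigma M N : Prop :=
  exists (X : Type) (Q : lmodType R)
    (p : {linear dsum X M -> Q}) (i : {linear N -> Q}),
    range p = setT /\ injective i.

Definition relatively_projective M N : Prop :=
  forall (X : lmodType R) (rho : {linear N -> X}) (alpha : {linear M -> X}),
    range rho = setT ->
    exists beta : {linear M -> N}, forall x, rho (beta x) = alpha x.

Definition projective_in_sigma M : Prop :=
  forall N, in_sigma M N -> relatively_projective M N.

Definition self_progenerator M : Prop :=
  projective_in_sigma M /\
  forall (N : set M) (hN : submodule N), generated M (submod hN).

End ModuleNotions.

Section LatticeNotions.
Variables (R : pzRingType) (M : lmodType R).
Implicit Types N L K : set M.

(* $\sum_{i \in D} N_i$: the finite sums of elements of the $N_i$ *)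
Definition msum (I : Type) (D : set I) (N : I -> set M) : set M :=
  [set x | exists2 s : seq M,
     forall y, y \in s -> exists2 i, D i & N i y & x = \sum_(y <- s) y].

Definition madd N L : set M := [set x + y | x in N & y in L].

Definition cyclic (n : M) : set M := range (fun a : R => a *: n).

Definition fully_invariant N : Prop :=
  submodule N /\ forall f : {linear M -> M}, f @` N `<=` N.

(* In mprod ($N_M L$) and ann ($\mathrm{Ann}_M(K)$), a homomorphism from M to
   a submodule L is represented by an endomorphism of M with range in L. *)
Definition mprod N L : set M :=
  msum [set f : {linear M -> M} | range f `<=` L] (fun f => f @` N).

Definition ann K : set M :=
  [set x | forall f : {linear M -> M}, range f `<=` K -> f x = 0].

Definition max_fi N : Prop :=
  [/\ fully_invariant N, N <> setT &
      forall K, fully_invariant K -> N `<=` K -> K = N \/ K = setT].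

Definition strongly_harmonic : Prop :=
  forall N L, max_fi N -> max_fi L -> N <> L ->
  exists N' L', [/\ fully_invariant N', fully_invariant L',
    ~ L' `<=` L, ~ N' `<=` N & mprod L' N' = [set 0]].

Definition fi_compact : Prop :=
  forall (I : Type) (N : I -> set M), (forall i, fully_invariant (N i)) ->
  msum setT N = setT -> exists2 F : set I, finite_set F & msum F N = setT.

Definition in_Psi N : Prop :=
  fully_invariant N /\
  forall n, N n -> madd N (ann (cyclic n)) = setT.

End LatticeNotions.

Section Facts.
Variables (R : pzRingType) (M : lmodType R).
Implicit Types N L K : set M.

Lemma mk_linear (V W : lmodType R) (g : V -> W) :
  linear g -> exists f : {linear V -> W}, f =1 g.
Proof.
move=> gl.
pose f : {linear V -> W} := HB.pack g (GRing.isLinear.Build R V W *:%R g gl).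
by exists f.
Qed.

Lemma submod_sum N (s : seq M) :
  submodule N -> (forall y, y \in s -> N y) -> N (\sum_(y <- s) y).
Proof.
move=> /submoduleP[N0 Nl]; elim: s => [|y s IH] Ns; first by rewrite big_nil.
rewrite big_cons -[y]scale1r; apply: Nl; first by apply: Ns; rewrite mem_head.
by apply: IH => z zs; apply: Ns; rewrite in_cons zs orbT.
Qed.

Lemma submodD N x y : submodule N -> N x -> N y -> N (x + y).
Proof. by move=> /submoduleP[_ Nl] Nx Ny; rewrite -[x]scale1r; apply: Nl. Qed.

Lemma submodZ N a x : submodule N -> N x -> N (a *: x).
Proof. by move=> /submoduleP[N0 Nl] Nx; rewrite -[_ *: _]addr0; apply: Nl. Qed.

Lemma submod0 N : submodule N -> N 0.
Proof. by move=> /submoduleP[]. Qed.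

Lemma msum_submod (I : Type) (D : set I) (N : I -> set M) :
  (forall i, D i -> submodule (N i)) -> submodule (msum D N).
Proof.
move=> Nsub; apply/submoduleP; split.
  by exists [::] => [//|]; rewrite big_nil.
move=> a _ _ [s sN ->] [t tN ->]; exists ([seq a *: y | y <- s] ++ t).
  move=> y; rewrite mem_cat => /orP[/mapP[z /sN[i Di Nz] ->]|/tN//].
  by exists i => //; apply: submodZ => //; apply: Nsub.
by rewrite big_cat big_map scaler_sumr.
Qed.

Lemma msum_ub (I : Type) (D : set I) (N : I -> set M) i :
  D i -> N i `<=` msum D N.
Proof.
move=> Di x Nx; exists [:: x]; last by rewrite big_seq1.
by move=> y; rewrite inE => /eqP ->; exists i.
Qed.

Lemma msum_le (I : Type) (D : set I) (N : I -> set M) K :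
  submodule K -> (forall i, D i -> N i `<=` K) -> msum D N `<=` K.
Proof.
move=> subK NK x [s sN ->]; apply: submod_sum => // y /sN[i Di].
exact: NK.
Qed.

Lemma madd_submod N L : submodule N -> submodule L -> submodule (madd N L).
Proof.
move=> hN hL; apply/submoduleP; split.
  by exists 0; [exact: submod0|exists 0; [exact: submod0|rewrite addr0]].
move=> a _ _ [x Nx [y Ly <-]] [x' Nx' [y' Ly' <-]].
exists (a *: x + x'); first by apply: submodD => //; apply: submodZ.
exists (a *: y + y'); first by apply: submodD => //; apply: submodZ.
by rewrite scalerDr addrACA.
Qed.

Lemma cyclic_submod (n : M) : submodule (cyclic n).
Proof.
apply/submoduleP; split; first by exists 0 => //; rewrite scale0r.
move=> a _ _ [b _ <-] [c _ <-]; exists (a * b + c) => //.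
by rewrite scalerDl scalerA.
Qed.

Lemma cyclic_id (n : M) : cyclic n n.
Proof. by exists 1 => //; rewrite scale1r. Qed.

Lemma setI_submod N L : submodule N -> submodule L -> submodule (N `&` L).
Proof.
move=> hN hL; apply/submoduleP; split; first by split; apply: submod0.
by move=> a u v [Nu Lu] [Nv Lv]; split; apply: submodD => //; apply: submodZ.
Qed.

Lemma setI_fi N L :
  fully_invariant N -> fully_invariant L -> fully_invariant (N `&` L).
Proof.
move=> [hN Nf] [hL Lf]; split; first exact: setI_submod.
by move=> f _ [x [Nx Lx] <-]; split; [apply: Nf|apply: Lf]; exists x.
Qed.

Lemma msum_fi (I : Type) (D : set I) (N : I -> set M) :
  (forall i, D i -> fully_invariant (N i)) -> fully_invariant (msum D N).
Proof.
move=> Nfi; split; first by apply: msum_submod => i /Nfi[].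
move=> f _ [_ [s sN ->] <-]; exists (map f s).
  move=> _ /mapP[y /sN[i Di Ny] ->]; exists i => //.
  by apply: (Nfi i Di).2; exists y.
by rewrite big_map linear_sum.
Qed.

Lemma madd_fi N L :
  fully_invariant N -> fully_invariant L -> fully_invariant (madd N L).
Proof.
move=> [hN Nf] [hL Lf]; split; first exact: madd_submod.
move=> f _ [_ [x Nx [y Ly <-]] <-]; rewrite linearD.
by exists (f x); [apply: Nf; exists x|exists (f y) => //; apply: Lf; exists y].
Qed.

Lemma setT_fi : fully_invariant [set: M].
Proof. by split => //; apply/submoduleP. Qed.

Lemma set0_fi : fully_invariant [set 0 : M].
Proof.
split; last by move=> f _ [_ -> <-]; apply: linear0.
by apply/submoduleP; split=> // a _ _ -> ->; rewrite scaler0 addr0.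
Qed.

Lemma fi_submod N : fully_invariant N -> submodule N.
Proof. by case. Qed.

Lemma comp_range (f g : {linear M -> M}) :
  exists h : {linear M -> M}, forall x, h x = f (g x).
Proof. by exists (f \o g)%FUN. Qed.

Lemma ann_submod K : submodule (ann K).
Proof.
apply/submoduleP; split; first by move=> f _; rewrite linear0.
by move=> a u v hu hv f hf; rewrite linearP hu // hv // scaler0 addr0.
Qed.

Lemma ann_fi K : fully_invariant (ann K).
Proof.
split; first exact: ann_submod.
move=> f _ [x hx <-] g hg; have [h hE] := comp_range g f.
rewrite -hE; apply: hx => _ [y _ <-]; rewrite hE; apply: hg.
by exists (f y).
Qed.

Lemma mprod_fi N L : submodule N -> fully_invariant L ->
  fully_invariant (mprod N L).
Proof.
move=> hN [hL Lf]; split.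
  apply: msum_submod => f fL; apply/submoduleP; split.
    by exists 0; [exact: submod0|rewrite linear0].
  move=> a _ _ [x Nx <-] [y Ny <-]; exists (a *: x + y); last by rewrite linearP.
  by apply: submodD => //; apply: submodZ.
move=> g _ [_ [s sN ->] <-]; exists (map g s); last first.
  by rewrite big_map linear_sum.
move=> _ /mapP[_ /sN[f fL [x Nx <-]] ->]; have [h hE] := comp_range g f.
exists h; last by exists x.
by move=> _ [y _ <-]; rewrite hE; apply: Lf; exists (f y) => //; apply: fL; exists y.
Qed.

Lemma mprod_ub N L (f : {linear M -> M}) x :
  range f `<=` L -> N x -> mprod N L (f x).
Proof. by move=> fL Nx; apply: (@msum_ub _ _ _ f) => //; exists x. Qed.

Lemma mprod_subr N L : submodule L -> mprod N L `<=` L.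
Proof.
by move=> hL; apply: msum_le => // f fL _ [x _ <-]; apply: fL; exists x.
Qed.

Lemma mprod_subl N L : fully_invariant N -> mprod N L `<=` N.
Proof. by move=> [hN Nf]; apply: msum_le => // f _; apply: Nf. Qed.

Section Total.
Variable I : choiceType.

Definition total (f : dsum I M) : M := \sum_(i \in [set: I]) f i.

Lemma dsum_supp (V : lmodType R) (f : dsum I V) : exists r : seq I,
  uniq r /\ forall i, f i <> 0 -> i \in r.
Proof.
case: f => f /= /asboolP /finite_fsetP[r fr]; exists (finmap.enum_fset r).
split=> [|i fi]; first exact: finmap.fset_uniq.
by have : [set x | f x <> 0] i by []; rewrite fr.
Qed.

Lemma totalE (f : dsum I M) (r : seq I) : uniq r ->
  (forall i, f i <> 0 -> i \in r) -> total f = \sum_(i <- r) f i.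
Proof.
move=> ur hr; rewrite /total (fsbigE r) //.
  by apply: eq_bigl => i; rewrite in_setT.
by move=> i _ /negP ir; apply: contrapT => fi; apply/ir/hr.
Qed.

Lemma dsumD (V : lmodType R) (f g : dsum I V) i : (f + g) i = f i + g i.
Proof. by []. Qed.

Lemma dsumZ (V : lmodType R) a (f : dsum I V) i : (a *: f) i = a *: f i.
Proof. by []. Qed.

Lemma total_linear : linear total.
Proof.
move=> a f g; have [rf [_ hf]] := dsum_supp f; have [rg [_ hg]] := dsum_supp g.
pose r := undup (rf ++ rg).
have ur : uniq r by apply: undup_uniq.
have hrf i : f i <> 0 -> i \in r by move=> /hf; rewrite mem_undup mem_cat => ->.
have hrg i : g i <> 0 -> i \in r.
  by move=> /hg; rewrite mem_undup mem_cat => ->; rewrite orbT.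
rewrite (totalE ur hrf) (totalE ur hrg) scaler_sumr -big_split.
rewrite (totalE ur) // => i; apply: contra_notP => ir.
have fi : f i = 0 by apply: contrapT => /hrf.
have gi : g i = 0 by apply: contrapT => /hrg.
by rewrite dsumD dsumZ fi gi scaler0 addr0.
Qed.

Lemma total_in (D : set I) (N : I -> set M) (f : dsum I M) :
  (forall i, D i -> N i (f i)) -> (forall i, ~ D i -> f i = 0) ->
  msum D N (total f).
Proof.
move=> fN fD; have [r [ur hr]] := dsum_supp f.
rewrite (totalE ur hr) (bigID (fun i => `[< D i >])) /= [X in _ + X]big1 ?addr0.
  exists [seq f i | i <- r & `[< D i >]]; last by rewrite big_map big_filter.
  move=> y /mapP[i]; rewrite mem_filter => /andP[/asboolP Di _] ->.
  by exists i => //; apply: fN.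
by move=> i /asboolP /fD.
Qed.

Definition inj_fun (V : lmodType R) (i : I) (x : V) : I -> V :=
  fun j => if j == i then x else 0.

Lemma inj_fun_supp (V : lmodType R) i (x : V) : inj_fun i x \in @fin_supp R I V.
Proof.
apply/asboolP; apply: (@sub_finite_set _ _ [set i]) => // j /=.
by rewrite /inj_fun; case: eqP.
Qed.

Definition inj_dsum (V : lmodType R) i (x : V) : dsum I V :=
  DSum (inj_fun_supp i x).

Lemma inj_dsum_linear V i : linear (@inj_dsum V i).
Proof.
move=> a x y; apply/val_inj/funext => j.
rewrite -[RHS]/(a *: inj_fun i x j + inj_fun i y j) /= /inj_fun.
by case: eqP; rewrite ?scaler0 ?addr0.
Qed.

Lemma total_inj i x : total (inj_dsum i x) = x.
Proof.
rewrite (@totalE _ [:: i]) //; last first.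
  by move=> j; rewrite /= /inj_fun inE; case: eqP.
by rewrite big_seq1 /= /inj_fun eqxx.
Qed.

Lemma dsum_sum (V : lmodType R) (f : dsum I V) : exists r : seq I,
  f = \sum_(i <- r) inj_dsum i (f i).
Proof.
have [r [ur hr]] := dsum_supp f; exists r; apply/val_inj/funext => j.
have evl : linear (fun g : dsum I V => g j) by move=> a u v.
have [ev evE] := mk_linear evl.
rewrite -[RHS]evE linear_sum.
under eq_bigr do rewrite evE /= /inj_fun.
have [jr|jr] := boolP (j \in r).
  rewrite (bigD1_seq j) //= eqxx big1 ?addr0 ?evE //.
  by move=> i /negPf; rewrite eq_sym => ->.
rewrite big1_seq; first by apply: contrapT => /hr; apply/negP.
by move=> i /andP[_ ir]; case: eqP => // ji; rewrite ji ir in jr.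
Qed.

End Total.

Lemma trace (hgen : forall N (hN : submodule N), generated M (submod hN)) N :
  submodule N -> mprod setT N = N.
Proof.
move=> hN; apply/seteqP; split; first exact: mprod_subr.
have [X [p pT]] := hgen N hN.
pose I : choiceType := {classic X}.
move=> x Nx; have Nx' : x \in smpred hN by rewrite inE.
have : [set: submod hN] (Submod Nx') by [].
rewrite -pT => -[d _ pd].
have -> : x = submod_val (p d) by rewrite pd.
have [r ->] := @dsum_sum I M d.
have vlin : linear (@submod_val R M N hN) by move=> a u v.
have [v vE] := mk_linear vlin.
rewrite -vE linear_sum linear_sum.
exists [seq v (p (@inj_dsum I M i (d i))) | i <- r]; last by rewrite big_map.
move=> _ /mapP[i _ ->].
have glin : linear (fun m => v (p (@inj_dsum I M i m))).
  by move=> a u w; rewrite inj_dsum_linear !linearP.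
have [g gE] := mk_linear glin.
exists g; last by exists (d i).
move=> _ [m _ <-]; rewrite gE vE; case: (p _) => y /=.
by rewrite inE.
Qed.

Section Lifting.
Hypothesis hproj : projective_in_sigma M.

Lemma lift_sum (I : choiceType) (D : set I) (N : I -> set M)
    (f : {linear M -> M}) :
  (forall i, D i -> submodule (N i)) -> range f `<=` msum D N ->
  exists beta : {linear M -> dsum I M},
    [/\ forall x i, D i -> N i (beta x i), forall x i, ~ D i -> beta x i = 0
      & forall x, f x = total (beta x)].
Proof.
move=> hN fN.
pose E : set (dsum I M) :=
  [set g | (forall i, D i -> N i (g i)) /\ (forall i, ~ D i -> g i = 0)].
have hE : submodule E.
  apply/submoduleP; split; first by split=> // i /hN; apply: submod0.
  move=> a u v [u1 u2] [v1 v2]; split=> i Di; rewrite dsumD dsumZ.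
    by apply: submodD; [exact: hN| apply: submodZ; [exact: hN|exact: u1]|exact: v1].
  by rewrite u2 // v2 // scaler0 addr0.
have hS : submodule (msum D N) by apply: msum_submod.
pose S := submod hS.
have rP (g : submod hE) : total (submod_val g) \in smpred hS.
  by case: g => g /= + ; rewrite !inE => -[g1 g2]; apply: total_in.
have rlin : linear (fun g => Submod (rP g) : S).
  by move=> a u v; apply: val_inj; rewrite /= -total_linear.
have [rho rhoE] := mk_linear rlin.
have aP x : f x \in smpred hS by rewrite inE; apply: fN; exists x.
have alin : linear (fun x => Submod (aP x) : S).
  by move=> a u v; apply: val_inj; rewrite /= linearP.
have [alpha alphaE] := mk_linear alin.
have hsig : in_sigma M (submod hE).
  have vlin : linear (@submod_val R (dsum I M) E hE) by move=> a u v.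
  have [v vE] := mk_linear vlin.
  exists I, (dsum I M), idfun, v; split.
    by apply/seteqP; split=> // x _; exists x.
  by move=> x y; rewrite !vE; apply: val_inj.
have rhoT : range rho = setT.
  apply/seteqP; split=> // -[y yS] _.
  have [s sN yE] : msum D N y by move: yS; rewrite inE.
  suff [g gE] : exists g : submod hE, total (submod_val g) = y.
    by exists g => //; apply: val_inj; rewrite rhoE.
  clear yS; elim: s y sN yE => [|z s IH] y sN yE.
    exists 0; rewrite yE big_nil /total /=.
    by apply: fsbig1.
  have [|g gE] := IH (\sum_(y <- s) y) _ erefl.
    by move=> w ws; apply: sN; rewrite in_cons ws orbT.
  have [i Di Nz] := sN z (mem_head _ _).
  have iE : inj_dsum i z \in smpred hE.
    rewrite inE; split=> j hj; rewrite /= /inj_fun; case: eqP => [ji|_] //.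
    - by rewrite ji.
    - by apply: submod0; apply: hN.
    - by rewrite ji in hj.
  exists (Submod iE + g).
  have -> : submod_val (Submod iE + g) = 1 *: inj_dsum i z + submod_val g.
    by rewrite scale1r.
  by rewrite total_linear scale1r total_inj gE yE big_cons.
have [beta betaE] := hproj hsig alpha rhoT.
have blin : linear (fun x => submod_val (beta x)).
  by move=> a u v; rewrite linearP.
have [b bE] := mk_linear blin.
have bin x : E (b x) by rewrite bE; case: (beta x) => g /=; rewrite inE.
exists b; split.
- by move=> x i; apply: (bin x).1.
- by move=> x i; apply: (bin x).2.
- move=> x; rewrite bE; have := betaE x.
  by rewrite rhoE alphaE => -[].
Qed.

Lemma coord_linear (I : choiceType) (b : {linear M -> dsum I M}) i :
  exists g : {linear M -> M}, forall x, g x = b x i.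
Proof. by apply: mk_linear => a u v; rewrite linearP. Qed.

Lemma split_id N L : submodule N -> submodule L -> madd N L = setT ->
  exists e1 e2 : {linear M -> M},
    [/\ range e1 `<=` N, range e2 `<=` L & forall x, x = e1 x + e2 x].
Proof.
move=> hN hL NL; pose F (b : bool) := if b then N else L.
have hF b : setT b -> submodule (F b) by case: b.
have hT : range (idfun : {linear M -> M}) `<=` msum setT F.
  move=> x _; have : [set: M] x by [].
  rewrite -NL => -[u Nu [v Lv <-]]; apply: submodD; first exact: msum_submod.
    exact: (@msum_ub _ setT F true).
  exact: (@msum_ub _ setT F false).
have [b [b1 _ b2]] := lift_sum hF hT.
have [e1 e1E] := coord_linear b true; have [e2 e2E] := coord_linear b false.
exists e1, e2; split.
- by move=> _ [x _ <-]; rewrite e1E; apply: (b1 x true).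
- by move=> _ [x _ <-]; rewrite e2E; apply: (b1 x false).
- move=> x; rewrite [LHS](b2 x) (@totalE _ _ [:: true; false]) //.
    by rewrite big_cons big_seq1 e1E e2E.
  by case=> //.
Qed.

Lemma comaxI N L K : submodule N -> fully_invariant N ->
  submodule L -> fully_invariant K ->
  madd N L = setT -> madd N K = setT -> madd N (L `&` K) = setT.
Proof.
move=> hN Nfi hL Kfi NL NK; apply/seteqP; split=> // x _.
have [e1 [e2 [e1N e2L eE]]] := split_id hN hL NL.
have : [set: M] x by [].
rewrite -NK => -[n Nn [k Kk <-]].
exists (n + e1 k); first by apply: submodD => //; apply: e1N; exists k.
exists (e2 k); last by rewrite -addrA -eE.
by split; [apply: e2L; exists k|apply: Kfi.2; exists k].
Qed.

Lemma in_Psi_setI N L : in_Psi N -> in_Psi L -> in_Psi (N `&` L).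
Proof.
move=> [Nfi hN] [Lfi hL]; split; first exact: setI_fi.
move=> n [Nn Ln]; apply/seteqP; split=> // x _.
have [e1 [e2 [e1N e2A eE]]] :=
  split_id (fi_submod Nfi) (ann_submod (cyclic n)) (hN n Nn).
have : [set: M] x by []; rewrite -(hL n Ln) => -[l Ll [a Aa <-]].
exists (e1 l).
  by split; [apply: e1N; exists l|apply: Lfi.2; exists l].
exists (e2 l + a); last by rewrite addrA -eE.
by apply: (submodD (ann_submod _)) => //; apply: e2A; exists l.
Qed.

Lemma in_Psi_msum (I : Type) (D : set I) (N : I -> set M) :
  (forall i, D i -> in_Psi (N i)) -> in_Psi (msum D N).
Proof.
move=> hN; have Sfi : fully_invariant (msum D N).
  by apply: msum_fi => i /hN[].
split=> // n [s sN nE].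
pose B (s : seq M) := [set x | forall y, y \in s -> ann (cyclic y) x].
have Bfi t : fully_invariant (B t).
  split.
    apply/submoduleP; split=> [y _|a u v hu hv y yt].
      exact: (submod0 (ann_submod _)).
    have ha := @ann_submod (cyclic y).
    by apply: (submodD ha); [apply: (submodZ _ ha); apply: hu|apply: hv].
  move=> f _ [x Bx <-] y yt; apply: (ann_fi _).2; exists x => //.
  exact: Bx.
have key t : (forall y, y \in t -> exists2 i, D i & N i y) ->
    madd (msum D N) (B t) = setT.
  elim: t => [|y t IH] tN; apply/seteqP; split=> // x _.
    by exists 0; [exact: (submod0 (fi_submod Sfi))|exists x => //; rewrite add0r].
  have [i Di Niy] := tN y (mem_head _ _).
  have h1 : madd (msum D N) (ann (cyclic y)) = setT.
    apply/seteqP; split=> // z _; have : [set: M] z by [].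
    rewrite -((hN i Di).2 y Niy) => -[u Nu [v Av <-]].
    by exists u; [apply: (@msum_ub _ _ _ i)|exists v].
  have h2 : madd (msum D N) (B t) = setT.
    by apply: IH => z zt; apply: tN; rewrite in_cons zt orbT.
  have : [set: M] x by [].
  rewrite -(comaxI (fi_submod Sfi) Sfi (ann_submod _) (Bfi t) h1 h2).
  move=> [u Nu [v [Av Bv] <-]]; exists u => //; exists v => //.
  by move=> z; rewrite in_cons => /orP[/eqP ->|/Bv].
apply/seteqP; split=> // x _; have : [set: M] x by [].
rewrite -(key s sN) => -[u Nu [v Bv <-]]; exists u => //; exists v => //.
move=> f fn.
have fs : range f `<=` msum [set y | y \in s] (@cyclic R M).
  move=> z /fn[a _ <-]; rewrite nE scaler_sumr.
  exists [seq a *: y | y <- s]; last by rewrite big_map.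
  by move=> _ /mapP[y ys ->]; exists y => //; exists a.
have [b [b1 b0 bE]] :=
  lift_sum (fun i (_ : [set y | y \in s] i) => cyclic_submod i) fs.
rewrite bE /total; apply: fsbig1 => y _.
have [ys|/b0//] := pselect (y \in s).
have [g gE] := coord_linear b y.
rewrite -gE; apply: (Bv y ys) => _ [z _ <-]; rewrite gE; exact: b1.
Qed.

Hypothesis hgen : forall N (hN : submodule N), generated M (submod hN).

Lemma in_Psi_distr (I : choiceType) (D : set I) (L : I -> set M) N :
  (forall i, D i -> fully_invariant (L i)) -> in_Psi N ->
  N `&` msum D L `<=` msum D (fun i => N `&` L i).
Proof.
move=> hL [Nfi hN] n [Nn Ln].
have [e1 [e2 [e1N e2A eE]]] :=
  split_id (fi_submod Nfi) (ann_submod (cyclic n)) (hN n Nn).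
have : cyclic n n by apply: cyclic_id.
rewrite -{1}(trace hgen (cyclic_submod n)).
apply: msum_le => [|f fn _ [m _ <-]].
  by apply: msum_submod => i Di; apply: setI_submod; apply: fi_submod => //; exact: hL.
rewrite (eE m) linearD [f (e2 m)](_ : _ = 0) ?addr0; last first.
  by apply: e2A => //; exists m.
have fL : range f `<=` msum D L.
  move=> z /fn[a _ <-]; apply: submodZ => //.
  by apply: msum_submod => i /hL/fi_submod.
have [b [b1 b0 bE]] := lift_sum (fun i Di => fi_submod (hL i Di)) fL.
rewrite bE; apply: total_in => i Di; last exact: b0.
split; last exact: b1.
have [g gE] := coord_linear b i; rewrite -gE; apply: Nfi.2.
by exists (e1 m) => //; apply: e1N; exists m.
Qed.

Lemma max_fi_prime P K L : max_fi P -> fully_invariant K -> fully_invariant L ->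
  mprod K L `<=` P -> K `<=` P \/ L `<=` P.
Proof.
move=> [Pfi PT Pmax] Kfi Lfi KLP.
have [KP|nKP] := pselect (K `<=` P); [by left|right].
have KPT : madd K P = setT.
  have PKP : P `<=` madd K P.
    move=> x Px; exists 0; first exact: (submod0 (fi_submod Kfi)).
    by exists x => //; rewrite add0r.
  case: (Pmax _ (madd_fi Kfi Pfi) PKP) => // E; case: nKP => x Kx.
  rewrite -E; exists x => //; exists 0; last by rewrite addr0.
  exact: (submod0 (fi_submod Pfi)).
rewrite -(trace hgen (fi_submod Lfi)).
apply: msum_le => [|f fL _ [m _ <-]]; first exact: fi_submod.
have : [set: M] m by []; rewrite -KPT => -[k Kk [p Pp <-]].
rewrite linearD; apply: submodD; first exact: fi_submod.
  by apply: KLP; apply: mprod_ub.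
by apply: Pfi.2; exists p.
Qed.

End Lifting.
End Facts.

(* The proof hM is not used in the carriers of the next two types: it is a
   parameter so that the frame structure and the topology, which depend on it,
   can be canonical. *)
Record Psi (R : pzRingType) (M : lmodType R) (hM : self_progenerator M) :=
  MkPsi { psi_val : set M; psi_valP : in_Psi psi_val }.

Record Maxfi (R : pzRingType) (M : lmodType R) (hM : self_progenerator M) :=
  MkMaxfi { maxfi_val : set M; maxfi_valP : max_fi maxfi_val }.

Section PsiFrame.
Variables (R : pzRingType) (M : lmodType R) (hM : self_progenerator M).
Local Notation T := (Psi hM).

HB.instance Definition _ := gen_eqMixin T.
HB.instance Definition _ := gen_choiceMixin T.

Lemma psi_val_inj : injective (@psi_val R M hM).
Proof.
by move=> [N hN] [L hL] /= NL; subst L; congr MkPsi; apply: Prop_irrelevance.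
Qed.

Definition psi_le (N L : T) : bool := `[< psi_val N `<=` psi_val L >].

Lemma psi_leP N L : reflect (psi_val N `<=` psi_val L) (psi_le N L).
Proof. exact: asboolP. Qed.

Lemma psi_le_refl : reflexive psi_le.
Proof. by move=> N; apply/psi_leP. Qed.

Lemma psi_le_anti : antisymmetric psi_le.
Proof.
move=> N L /andP[/psi_leP NL /psi_leP LN].
by apply/psi_val_inj/seteqP.
Qed.

Lemma psi_le_trans : transitive psi_le.
Proof.
by move=> N L K /psi_leP LN /psi_leP NK; apply/psi_leP; apply: subset_trans NK.
Qed.

HB.instance Definition _ := Order.Le_isPOrder.Build (Order.Disp tt tt) T
  psi_le_refl psi_le_anti psi_le_trans.

Definition psi_meet (N L : T) : T :=
  MkPsi hM (in_Psi_setI hM.1 (psi_valP N) (psi_valP L)).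

Definition psi_bigjoin (A : set T) : T :=
  MkPsi hM (in_Psi_msum hM.1 (fun N (_ : A N) => psi_valP N)).

Definition psi_join (N L : T) : T := psi_bigjoin [set N; L].

Lemma psi_bigjoin_ub (A : set T) (N : T) : A N -> (N <= psi_bigjoin A)%O.
Proof. by move=> AN; apply/psi_leP; apply: msum_ub. Qed.

Lemma psi_bigjoin_le (A : set T) (L : T) :
  (forall N, A N -> (N <= L)%O) -> (psi_bigjoin A <= L)%O.
Proof.
move=> AL; apply/psi_leP; apply: msum_le => [|N /AL /psi_leP //].
by apply: fi_submod; case: (psi_valP L).
Qed.

Lemma psi_meetP N L K : (N <= psi_meet L K)%O = (N <= L)%O && (N <= K)%O.
Proof.
apply/psi_leP/andP => [NLK|[/psi_leP NL /psi_leP NK] x Nx].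
  by split; apply/psi_leP => x /NLK[].
by split; [apply: NL|apply: NK].
Qed.

Lemma psi_joinP N L K : (psi_join N L <= K)%O = (N <= K)%O && (L <= K)%O.
Proof.
apply/idP/andP => [NLK|[NK LK]].
  by split; apply: le_trans NLK; apply: psi_bigjoin_ub; [left|right].
by apply: psi_bigjoin_le => P [] ->.
Qed.

HB.instance Definition _ := Order.POrder_MeetJoin_isLattice.Build
  (Order.Disp tt tt) T psi_meetP psi_joinP.

Lemma in_Psi0 : in_Psi [set 0 : M].
Proof.
split=> [|_ ->]; first exact: set0_fi.
apply/seteqP; split=> // x _; exists 0 => //; exists x; last by rewrite add0r.
move=> f f0; have [|a _ <-] := f0 (f x); first by exists x.
by rewrite scaler0.
Qed.

Lemma in_PsiT : in_Psi [set: M].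
Proof.
split=> [|n _]; first exact: setT_fi.
apply/seteqP; split=> // x _; exists x => //; exists 0; last by rewrite addr0.
exact: (submod0 (ann_submod _)).
Qed.

Lemma psi_le0 (N : T) : (MkPsi hM in_Psi0 <= N)%O.
Proof.
by apply/psi_leP => _ ->; apply: (submod0 (fi_submod (psi_valP N).1)).
Qed.

Lemma psi_le1 (N : T) : (N <= MkPsi hM in_PsiT)%O.
Proof. exact/psi_leP. Qed.

HB.instance Definition _ := Order.hasBottom.Build (Order.Disp tt tt) T psi_le0.
HB.instance Definition _ := Order.hasTop.Build (Order.Disp tt tt) T psi_le1.

Lemma psi_meet_bigjoin (N : T) (A : set T) :
  Order.meet N (psi_bigjoin A) = psi_bigjoin [set Order.meet N L | L in A].
Proof.
apply: le_anti; apply/andP; split.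
- apply/psi_leP; apply: subset_trans.
    apply: (in_Psi_distr hM.1 hM.2 _ (psi_valP N)).
    by move=> L _; case: (psi_valP L).
  apply: msum_le => [|L AL].
    by apply: (fi_submod (psi_valP (psi_bigjoin _)).1).
  have : [set Order.meet N L | L in A] (Order.meet N L) by exists L.
  by move=> /psi_bigjoin_ub /psi_leP.
- apply: psi_bigjoin_le => _ [L AL <-]; rewrite lexI leIl.
  by apply: le_trans (psi_bigjoin_ub AL); apply: leIr.
Qed.

HB.instance Definition _ := TBLattice_isFrame.Build (Order.Disp tt tt) T
  psi_bigjoin_ub psi_bigjoin_le psi_meet_bigjoin.

End PsiFrame.

Section MaxfiTopology.
Variables (R : pzRingType) (M : lmodType R) (hM : self_progenerator M).
Local Notation T := (Maxfi hM).

HB.instance Definition _ := gen_eqMixin T.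
HB.instance Definition _ := gen_choiceMixin T.

Definition maxfi_open : set_system T :=
  [set U | exists2 K : set M, fully_invariant K &
    U = [set P : T | ~ K `<=` maxfi_val P]].

Lemma maxfi_openT : maxfi_open setT.
Proof.
exists setT; first exact: setT_fi.
apply/seteqP; split=> // P _ /= TP; have [_ nT _] := maxfi_valP P.
by apply: nT; apply/seteqP.
Qed.

Lemma maxfi_openI : setI_closed maxfi_open.
Proof.
move=> _ _ [K Kfi ->] [L Lfi ->]; exists (mprod K L).
  exact: (mprod_fi (fi_submod Kfi)).
apply/seteqP; split=> P /=.
- by move=> [nK nL] /(max_fi_prime hM.2 (maxfi_valP P) Kfi Lfi)[].
- move=> nKL; split=> KP; apply: nKL; apply: subset_trans KP.
    exact: mprod_subl.
  exact: (mprod_subr (fi_submod Lfi)).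
Qed.

Lemma maxfi_open_bigU (I : Type) (f : I -> set T) :
  (forall i, maxfi_open (f i)) -> maxfi_open (\bigcup_i f i).
Proof.
move=> fop.
pose D := [set K : set M | fully_invariant K /\
  exists i, f i = [set P : T | ~ K `<=` maxfi_val P]].
exists (msum D id); first by apply: msum_fi => K [].
apply/seteqP; split=> P /=.
- move=> [i _ fiP] le_P; have [K Kfi fi] := fop i.
  move: fiP; rewrite fi /=; apply; apply: subset_trans le_P.
  by apply: (@msum_ub _ _ _ _ id); split => //; exists i.
- move=> nle; apply: contrapT => nP; apply: nle; apply: msum_le.
    by apply: fi_submod; case: (maxfi_valP P).
  move=> K [_ [i fi]]; apply: contrapT => nK; apply: nP; exists i => //.
  by rewrite fi.
Qed.

HB.instance Definition _ := isOpenTopological.Build T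
  maxfi_openT maxfi_openI maxfi_open_bigU.

End MaxfiTopology.

(* Main.v *)
Require Import Defs.
From HB Require Import structures.
From mathcomp Require Import all_boot all_order all_algebra.
From mathcomp Require Import all_classical topology.

(** Write $\mathrm{int}(K)$ for the sum of the fully invariant $N$ with
    $K + \mathrm{Ann}_M(N) = M$. These $N$ form a directed family, because $M$
    is projective in $\sigma[M]$ ([ann_madd], [comaxI]); they lie in $K$ when
    $K$ is fully invariant, because $M$ generates its submodules
    ([sub_of_madd_ann]). For such $K$, two facts then carry the proof.

    First, a coatom contains $K$ iff it contains $\mathrm{int}(K)$
    ([interior_sub_max_fi]). Let $m$ be a coatom with $K \nleq m$. Strong
    harmonicity separates $m$ from each coatom above $K$, so no coatom contains
    all the $K + \mathrm{Ann}_M(N)$ with $N$ fully invariant and $N \nleq m$.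
    This family is directed, so by compactness one of its members is $M$, and
    its $N$ is a part of $\mathrm{int}(K)$ outside $m$. It follows that
    $\mathrm{int}(K)$ belongs to $\Psi(M)$ ([interior_in_Psi]): a coatom above
    $\mathrm{int}(K) + \mathrm{Ann}_M(Rn)$ would contain
    $K + \mathrm{Ann}_M(Rn) = M$.

    Second, for $A \in \Psi(M)$ and $B$ fully invariant, $A \leq B$ as soon as
    every coatom above $B$ is above $A$ ([Psi_sub_of_max_fi]).

    Hence $\Psi(M)$ is the frame of open sets of $Max^{fi}(M)$, and the result
    is the sobriety of this Hausdorff space, made explicit: above a point $p$
    of $\Psi(M)$ there is exactly one coatom $m$, and $p = \mathrm{int}(m)$.
    Indeed, harmonicity gives for two distinct coatoms fully invariant
    submodules whose interiors intersect inside every coatom, while primeness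
    of $p$ would put one of the two below $p$, hence below both coatoms. *)

Set Implicit Arguments.
Unset Strict Implicit.
Unset Printing Implicit Defensive.

Import Order.TTheory GRing.Theory.

Local Open Scope ring_scope.
Local Open Scope classical_set_scope.

(** * Directed families of submodules and compactness *)

Definition directed_sets (T : Type) (D : set (set T)) : Prop :=
  forall A B, D A -> D B -> exists2 C, D C & A `|` B `<=` C.

Section Interior.
Variables (R : pzRingType) (M : lmodType R).
Implicit Types (A B K L N P Q : set M) (D : set (set M)).

Lemma msum_directed D : D !=set0 -> (forall A, D A -> submodule A) ->
  directed_sets D -> msum D id `<=` \bigcup_(A in D) A.
Proof.
move=> [A0 DA0] Dsub Ddir x [s sD ->] {x}; elim: s sD => [|y s IH] sD.
  by rewrite big_nil; exists A0 => //; apply: submod0; apply: Dsub.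
have [A DA Ay] := sD y (mem_head _ _).
have [|B DB Bs] := IH; first by move=> z zs; apply: sD; rewrite in_cons zs orbT.
have [C DC ABC] := Ddir _ _ DA DB.
exists C => //; rewrite big_cons.
by apply: submodD; [exact: Dsub|apply: ABC; left|apply: ABC; right].
Qed.

Lemma fi_compact_directed D : fi_compact M -> D !=set0 ->
  (forall A, D A -> fully_invariant A) -> directed_sets D ->
  msum D id = setT -> D setT.
Proof.
move=> hcomp [A0 DA0] Dfi Ddir DT.
pose I : choiceType := {classic {A : set M | D A}}.
pose F (i : I) : set M := sval i.
have FD i : D (F i) by apply: svalP i.
have [|J finJ JT] := hcomp I F (fun i => Dfi _ (FD i)).
  apply/seteqP; split=> // x _; have : [set: M] x by [].
  rewrite -DT; apply: msum_le => [|A DA].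
    by apply: msum_submod => i _; apply: fi_submod; exact: Dfi.
  exact: (@msum_ub _ _ I setT F (exist _ A DA)).
have [s sJ] := (finite_seqP J).1 finJ.
have [C DC sC] : exists2 C, D C & forall i, i \in s -> F i `<=` C.
  elim: s {sJ} => [|i s [B DB sB]]; first by exists A0.
  have [C DC FBC] := Ddir _ _ (FD i) DB; exists C => // j.
  rewrite in_cons => /orP[/eqP -> x Fx|/sB jB x /jB Bx].
    by apply: FBC; left.
  by apply: FBC; right.
suff -> : [set: M] = C by [].
apply/seteqP; split=> // x _; have : [set: M] x by [].
rewrite -JT; apply: msum_le => [|i]; first exact/fi_submod/Dfi.
by rewrite sJ => /sC.
Qed.

(** * Coatoms *)

Lemma max_fi_above K : fi_compact M -> fully_invariant K -> K <> setT ->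
  exists2 P, max_fi P & K `<=` P.
Proof.
move=> hcomp Kfi KT.
pose proper := [set A | [/\ fully_invariant A, A <> setT & K `<=` A]].
(* The empty set is admitted only to cover the union of the empty chain. *)
have [F Fproper Ftot|A [[A0|[Afi AT KA]] Amax]] :=
    @Zorn_bigcup _ (fun A => A = set0 \/ proper A).
- pose D := F `&` proper.
  have [[B DB]|noD] := pselect (D !=set0); last first.
    left; apply/seteqP; split=> // x [A FA Ax].
    case: (Fproper A FA) => [A0|Ap]; first by rewrite A0 in Ax.
    by apply: noD; exists A.
  have Ddir : directed_sets D.
    move=> A C DA DC; case: (Ftot A C DA.1 DC.1) => [AC|CA].
      by exists C => // x [/AC|].
    by exists A => // x [|/CA].
  have Dfi A : D A -> fully_invariant A by case=> _ [].
  have -> : \bigcup_(A in F) A = msum D id.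
    apply/seteqP; split=> x.
      move=> [A FA Ax]; case: (Fproper A FA) => [A0|Ap].
        by rewrite A0 in Ax.
      by apply: (@msum_ub _ _ _ D id A).
    have Dsub A : D A -> submodule A by move=> /Dfi /fi_submod.
    by case/(msum_directed (ex_intro _ B DB) Dsub Ddir) => A [FA _] Ax; exists A.
  right; split; first exact: msum_fi.
    by move=> /(fi_compact_directed hcomp (ex_intro _ B DB) Dfi Ddir)[_ []].
  by apply: subset_trans (@msum_ub _ _ _ D id B DB); case: DB => _ [].
- exfalso; apply: (Amax K); last by right; split.
  rewrite A0 properEneq; split=> //; apply/eqP => K0.
  by have := submod0 (fi_submod Kfi); rewrite -K0.
- exists A => //; split=> // L Lfi AL.
  have [->|LT] := pselect (L = setT); [by right|left].
  apply: contrapT => LA; apply: (Amax L).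
    by rewrite properEneq; split=> //; apply/eqP => /esym.
  by right; split=> //; apply: subset_trans AL.
Qed.

Lemma fi_eq_setT K : fi_compact M -> fully_invariant K ->
  (forall P, max_fi P -> ~ K `<=` P) -> K = setT.
Proof.
by move=> hcomp Kfi noP; apply: contrapT => /(max_fi_above hcomp Kfi)[P /noP].
Qed.

Lemma max_fi_proper P : max_fi P -> ~ setT `<=` P.
Proof. by move=> [_ PT _] TP; apply: PT; apply/seteqP. Qed.

Lemma max_fi_eq P Q : max_fi P -> max_fi Q -> P `<=` Q -> P = Q.
Proof. by move=> [_ _ Pmax] [Qfi QT _] /(Pmax _ Qfi)[|/QT]. Qed.

Lemma madd_subl K L : submodule L -> K `<=` madd K L.
Proof. by move=> /submod0 L0 x Kx; exists x => //; exists 0; rewrite ?addr0. Qed.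

Lemma madd_subr K L : submodule K -> L `<=` madd K L.
Proof. by move=> /submod0 K0 x Lx; exists 0 => //; exists x; rewrite ?add0r. Qed.

Lemma madd_le K L N : submodule N -> K `<=` N -> L `<=` N -> madd K L `<=` N.
Proof.
by move=> hN KN LN _ [x /KN Nx [y /LN Ny <-]]; apply: submodD.
Qed.

Lemma madd_setT K L N : L `<=` N -> madd K L = setT -> madd K N = setT.
Proof.
move=> LN KL; apply/seteqP; split=> // x _; have : [set: M] x by [].
by rewrite -KL => -[u Ku [v /LN Nv <-]]; exists u => //; exists v.
Qed.

(** * Annihilators *)

Lemma ann_anti K L : K `<=` L -> ann L `<=` ann K.
Proof. by move=> KL x Lx f fK; apply: Lx; apply: subset_trans KL. Qed.

Lemma mprod_eq0_ann L N : mprod L N = [set 0] -> L `<=` ann N.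
Proof.
move=> LN x Lx f fN; have := mprod_ub fN Lx.
by rewrite LN.
Qed.

Hypothesis hM : self_progenerator M.

(** By projectivity, a map into $K + L$ is the sum of a map into $K$ and a map
    into $L$. *)
Lemma ann_madd K L : submodule K -> submodule L ->
  ann K `&` ann L `<=` ann (madd K L).
Proof.
move=> hK hL x [Kx Lx] f fKL; pose F (b : bool) := if b then K else L.
have hF b : setT b -> submodule (F b) by case: b.
have fF : range f `<=` msum setT F.
  move=> y /fKL[u Ku [v Lv <-]].
  apply: submodD; first exact: msum_submod.
    exact: (@msum_ub _ _ _ setT F true).
  exact: (@msum_ub _ _ _ setT F false).
have [b [bF _ fE]] := lift_sum hM.1 hF fF.
have [g1 g1E] := coord_linear b true; have [g2 g2E] := coord_linear b false.
rewrite fE (@totalE _ _ _ _ [:: true; false]) //; last by case.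
rewrite big_cons big_seq1 -g1E -g2E Kx ?Lx ?addr0 // => _ [y _ <-].
  by rewrite g2E; apply: (bF y false).
by rewrite g1E; apply: (bF y true).
Qed.

(** Every $x \in L$ is a sum of images $f(m)$ with $f : M \to L$, and the part
    of $m$ in $\mathrm{Ann}_M(L)$ is killed by $f$. *)
Lemma sub_of_madd_ann K L : fully_invariant K -> submodule L ->
  madd K (ann L) = setT -> L `<=` K.
Proof.
move=> Kfi hL KL; rewrite -(trace hM.2 hL).
apply: msum_le => [|f fL _ [m _ <-]]; first exact: fi_submod.
have : [set: M] m by []; rewrite -KL => -[u Ku [v Lv <-]].
by rewrite linearD (Lv f fL) addr0; apply: Kfi.2; exists u.
Qed.

Lemma cyclic_sub N x : submodule N -> N x -> cyclic x `<=` N.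
Proof. by move=> hN Nx _ [a _ <-]; apply: submodZ. Qed.

(** * The interior of a fully invariant submodule *)

Definition interior_family K : set (set M) :=
  [set N | fully_invariant N /\ madd K (ann N) = setT].

Definition interior K : set M := msum (interior_family K) id.

Lemma interior_fi K : fully_invariant (interior K).
Proof. by apply: msum_fi => N []. Qed.

Lemma interior_sub K : fully_invariant K -> interior K `<=` K.
Proof.
move=> Kfi; apply: msum_le => [|N [Nfi KN]]; first exact: fi_submod.
by apply: sub_of_madd_ann => //; apply: fi_submod.
Qed.

(** The family is directed, so $x$ lies in a single member $N$, and
    $\mathrm{Ann}_M(N) \leq \mathrm{Ann}_M(Rx)$. *)
Lemma madd_ann_interior K x : fully_invariant K -> interior K x ->
  madd K (ann (cyclic x)) = setT.
Proof.
move=> Kfi Ix.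
have [||A B [Afi KA] [Bfi KB]|N [Nfi KN] Nx] :=
    @msum_directed (interior_family K) _ _ _ x Ix.
- exists [set 0]; split; first exact: set0_fi.
  apply/seteqP; split=> // y _.
  apply: madd_subr; first exact: fi_submod.
  by move=> f f0; apply: f0; exists y.
- by move=> A [/fi_submod].
- exists (madd A B); last first.
    move=> y [Ay|By]; first by apply: madd_subl => //; apply: fi_submod.
    by apply: madd_subr => //; apply: fi_submod.
  split; first exact: madd_fi.
  apply: madd_setT (ann_madd (fi_submod Afi) (fi_submod Bfi)) _.
  by apply: comaxI => //; [exact: hM.1|exact: fi_submod|exact: ann_submod|exact: ann_fi].
- apply: madd_setT KN; apply: ann_anti; apply: cyclic_sub => //; exact: fi_submod.
Qed.

Hypothesis hcomp : fi_compact M.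

(** If some $x \in A$ were outside $B$, then $B + \mathrm{Ann}_M(Rx) \neq M$
    by [sub_of_madd_ann], and a coatom above it would contain $A$, hence
    $A + \mathrm{Ann}_M(Rx) = M$. *)
Lemma Psi_sub_of_max_fi A B : in_Psi A -> fully_invariant B ->
  (forall P, max_fi P -> B `<=` P -> A `<=` P) -> A `<=` B.
Proof.
move=> [Afi Ann_A] Bfi AB x Ax.
suff BT : madd B (ann (cyclic x)) = setT.
  by apply: (sub_of_madd_ann Bfi (cyclic_submod x) BT); apply: cyclic_id.
apply: fi_eq_setT => // [|P Pmax BP]; first by apply: madd_fi => //; apply: ann_fi.
apply: (max_fi_proper Pmax); rewrite -(Ann_A x Ax).
have Psub : submodule P by case: Pmax => /fi_submod.
apply: madd_le => //.
  by apply: AB => //; apply: subset_trans BP; apply: madd_subl; exact: ann_submod.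
by apply: subset_trans BP; apply: madd_subr; exact: fi_submod.
Qed.

Hypothesis hharm : strongly_harmonic M.

(** The submodules $K + \mathrm{Ann}_M(N)$ with $N \nleq P$ form a directed
    family since $P$ is prime, and by harmonicity a coatom above all of them
    would have to be $P$, which does not contain $K$. *)
Lemma madd_ann_off_max_fi K P : fully_invariant K -> max_fi P -> ~ K `<=` P ->
  exists N, [/\ fully_invariant N, ~ N `<=` P & madd K (ann N) = setT].
Proof.
move=> Kfi Pmax KP.
pose D : set (set M) :=
  [set madd K (ann N) | N in [set N | fully_invariant N /\ ~ N `<=` P]].
have Dfi A : D A -> fully_invariant A.
  by case=> N _ <-; apply: madd_fi => //; apply: ann_fi.
have DI N : fully_invariant N -> ~ N `<=` P -> D (madd K (ann N)).
  by move=> Nfi NP; exists N.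
suff [N [Nfi NP] KN] : D setT by exists N.
apply: fi_compact_directed => //.
- by exists (madd K (ann setT)); apply: DI; [exact: setT_fi|exact: max_fi_proper].
- move=> _ _ [N [Nfi NP] <-] [L [Lfi LP] <-].
  exists (madd K (ann (N `&` L))).
    apply: DI => [|NLP]; first exact: setI_fi.
    have [] // := max_fi_prime hM.2 Pmax Nfi Lfi.
    apply: subset_trans NLP => x NLx; split; first exact: (mprod_subl Nfi NLx).
    exact: (mprod_subr (fi_submod Lfi) NLx).
  have sub A : N `&` L `<=` A -> madd K (ann A) `<=` madd K (ann (N `&` L)).
    by move=> NLA _ [u Ku [v Av <-]]; exists u => //; exists v => //; apply: ann_anti Av.
  by move=> x [] /sub; apply=> y [].
- apply: fi_eq_setT => // [|Q Qmax DQ]; first exact: msum_fi.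
  have DleQ A : D A -> A `<=` Q.
    by move=> DA; apply: subset_trans DQ; apply: (@msum_ub _ _ _ D id).
  have PQ : P <> Q.
    move=> PQ; apply: KP; rewrite PQ.
    apply: subset_trans (DleQ _ (DI setT (setT_fi M) (max_fi_proper Pmax))).
    apply: madd_subl; exact: ann_submod.
  have [N [L [Nfi Lfi LQ NP LN]]] := hharm Pmax Qmax PQ.
  apply: LQ; apply: subset_trans (mprod_eq0_ann LN) _.
  by apply: subset_trans (DleQ _ (DI N Nfi NP)); apply: madd_subr; exact: fi_submod.
Qed.

Lemma interior_sub_max_fi K P : fully_invariant K -> max_fi P ->
  interior K `<=` P -> K `<=` P.
Proof.
move=> Kfi Pmax IP; apply: contrapT.
move=> /(madd_ann_off_max_fi Kfi Pmax)[N [Nfi NP KN]].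
by apply: NP; apply: subset_trans IP; apply: (@msum_ub _ _ _ _ id).
Qed.

Lemma interior_in_Psi K : fully_invariant K -> in_Psi (interior K).
Proof.
move=> Kfi; split; first exact: interior_fi.
have Isub := fi_submod (interior_fi K).
move=> x Ix; apply: fi_eq_setT => // [|P Pmax IP].
  by apply: madd_fi; [exact: interior_fi|exact: ann_fi].
apply: (max_fi_proper Pmax); rewrite -(madd_ann_interior Kfi Ix).
apply: madd_le; first by case: Pmax => /fi_submod.
  apply: interior_sub_max_fi => //.
  by apply: subset_trans IP; apply: madd_subl; exact: ann_submod.
by apply: subset_trans IP; apply: madd_subr.
Qed.

Lemma Psi_sub_interior A P : in_Psi A -> max_fi P -> A `<=` P ->
  A `<=` interior P.
Proof.
move=> Apsi Pmax AP; apply: Psi_sub_of_max_fi => // [|Q Qmax IQ].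
  exact: interior_fi.
apply: subset_trans AP _; apply: interior_sub_max_fi => //.
by case: Pmax.
Qed.

(** * The homeomorphism *)

Lemma Psi_leE (A B : Psi hM) : (A <= B)%O <-> psi_val A `<=` psi_val B.
Proof. by split=> /psi_leP. Qed.

Definition interior_Psi K (Kfi : fully_invariant K) : Psi hM :=
  MkPsi hM (interior_in_Psi Kfi).

Lemma interior_neq1 P (Pmax : max_fi P) (Pfi : fully_invariant P) :
  interior_Psi Pfi <> \top%O.
Proof.
move=> /(congr1 (@psi_val _ _ hM)) /= IT.
by apply: (max_fi_proper Pmax); rewrite -IT; apply: interior_sub.
Qed.

Lemma interior_prime P (Pmax : max_fi P) (Pfi : fully_invariant P) :
  forall A B : Psi hM, (Order.meet A B <= interior_Psi Pfi)%O ->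
    (A <= interior_Psi Pfi)%O \/ (B <= interior_Psi Pfi)%O.
Proof.
move=> A B /Psi_leE AB; have [Afi _] := psi_valP A; have [Bfi _] := psi_valP B.
have ABP : mprod (psi_val A) (psi_val B) `<=` P.
  move=> x ABx; apply: (interior_sub Pfi); apply: AB; split.
    exact: (mprod_subl Afi ABx).
  exact: (mprod_subr (fi_submod Bfi) ABx).
by have [|] := max_fi_prime hM.2 Pmax Afi Bfi ABP; [left|right];
  apply/Psi_leE/Psi_sub_interior => //; apply: psi_valP.
Qed.

Definition pt_of_max_fi (m : Maxfi hM) : pt (Psi hM) :=
  let: And3 mfi _ _ := maxfi_valP m in
  Pt (@interior_neq1 _ (maxfi_valP m) mfi) (@interior_prime _ (maxfi_valP m) mfi).

Lemma pt_of_max_fiE (m : Maxfi hM) :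
  psi_val (pt_val (pt_of_max_fi m)) = interior (maxfi_val m).
Proof. by rewrite /pt_of_max_fi; case: (maxfi_valP m). Qed.

Lemma max_fi_above_pt (p : pt (Psi hM)) :
  exists m : Maxfi hM, psi_val (pt_val p) `<=` maxfi_val m.
Proof.
have [P Pmax pP] : exists2 P, max_fi P & psi_val (pt_val p) `<=` P.
  apply: max_fi_above => //; first by case: (psi_valP (pt_val p)).
  by move=> pT; apply: (@pt_neq1 _ _ p); apply: psi_val_inj.
by exists (MkMaxfi hM Pmax).
Qed.

(** Harmonicity gives $L \nleq Q$ and $N \nleq P$ with $L_M N = 0$. Every coatom
    contains $L$ or $N$, hence $\mathrm{int}(L) \cap \mathrm{int}(N)$, which is
    therefore below $p$; so $\mathrm{int}(L)$ or $\mathrm{int}(N)$ is. *)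
Lemma max_fi_above_pt_uniq (p : pt (Psi hM)) P Q : max_fi P -> max_fi Q ->
  psi_val (pt_val p) `<=` P -> psi_val (pt_val p) `<=` Q -> P = Q.
Proof.
move=> Pmax Qmax pP pQ; apply: contrapT => PQ.
have [N [L [Nfi Lfi LQ NP LN]]] := hharm Pmax Qmax PQ.
have LNp : (Order.meet (interior_Psi Lfi) (interior_Psi Nfi) <= pt_val p)%O.
  apply/Psi_leE; apply: Psi_sub_of_max_fi => [||S Smax _].
  - exact: psi_valP.
  - by case: (psi_valP (pt_val p)).
  have LNS : mprod L N `<=` S.
    by rewrite LN => _ ->; apply: submod0; case: Smax => -[].
  case: (max_fi_prime hM.2 Smax Lfi Nfi LNS) => [LS x [Lx _]|NS x [_ Nx]].
    by apply: LS; apply: interior_sub Lx.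
  by apply: NS; apply: interior_sub Nx.
case: (pt_prime LNp) => /Psi_leE le_p.
  by apply: LQ; apply: interior_sub_max_fi => //; apply: subset_trans pQ.
by apply: NP; apply: interior_sub_max_fi => //; apply: subset_trans pP.
Qed.

Lemma pt_eq_interior (p : pt (Psi hM)) P : max_fi P ->
  psi_val (pt_val p) `<=` P -> psi_val (pt_val p) = interior P.
Proof.
move=> Pmax pP; have Pfi : fully_invariant P by case: Pmax.
apply/seteqP; split; first by apply: Psi_sub_interior => //; apply: psi_valP.
apply: Psi_sub_of_max_fi => [||Q Qmax pQ].
- exact: interior_in_Psi.
- by case: (psi_valP (pt_val p)).
- by rewrite -(max_fi_above_pt_uniq Pmax Qmax pP pQ); apply: interior_sub.
Qed.

End Interior.

Lemma pt_val_inj d (A : frameType d) : injective (@pt_val d A).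
Proof.
by move=> [a a1 ap] [b b1 bp] /= ab; subst b; congr Pt; apply: Prop_irrelevance.
Qed.

Theorem proposition4p23 (R : pzRingType) (M : lmodType R)
    (hM : self_progenerator M)
    (hharm : strongly_harmonic M)
    (hcomp : fi_compact M) :
  homeomorphic (pt (Psi hM)) (Maxfi hM).
Proof.
have [f pf] := choice (max_fi_above_pt hcomp (hM := hM)).
pose g := pt_of_max_fi hcomp hharm (hM := hM).
have fK : cancel f g.
  move=> p; apply/pt_val_inj/psi_val_inj; rewrite pt_of_max_fiE.
  by symmetry; apply: pt_eq_interior => //; apply: maxfi_valP.
have gK : cancel g f.
  move=> m; case: (f (g m)) (pf (g m)) => P Pmax /=; rewrite pt_of_max_fiE.
  case: m => Q Qmax /= IP; have Qfi : fully_invariant Q by case: Qmax.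
  have QP : Q = P by apply: max_fi_eq => //; apply: interior_sub_max_fi IP.
  by subst Q; congr MkMaxfi; apply: Prop_irrelevance.
exists f; split; first by exists g.
- apply/continuousP => _ [K Kfi ->].
  exists (interior_Psi hM hcomp hharm Kfi); apply/seteqP; split=> p /=.
    move=> KP /Psi_leE Ip; apply: KP.
    apply: (interior_sub_max_fi hM hcomp hharm) => //; first exact: maxfi_valP.
    exact: subset_trans (pf p).
  move=> nle Kf; apply: nle; apply/Psi_leE.
  rewrite -[p]fK pt_of_max_fiE; apply: Psi_sub_interior => //.
  - exact: interior_in_Psi.
  - exact: maxfi_valP.
  - exact: subset_trans (interior_sub hM Kfi) Kf.
- move=> _ [a ->]; have [afi _] := psi_valP a.
  exists (psi_val a) => //; apply/seteqP; split=> m /=.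
    move=> [p nle <-] af; apply: nle; apply/Psi_leE.
    rewrite -[p]fK pt_of_max_fiE; apply: Psi_sub_interior => //.
      exact: psi_valP.
    exact: maxfi_valP.
  move=> am; exists (g m) => // /Psi_leE; rewrite pt_of_max_fiE => aI; apply: am.
  by apply: subset_trans aI _; apply: interior_sub => //; case: (maxfi_valP m).
Qed.
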